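(* Let $\mathcal K$ and $\varpi(\cdot)$ be as in the context, $U\in\mathbb S^n_{\succ0}$, and let $\boldsymbol f(\cdot)\in\mathcal L^2_\varpi(\mathcal K;\mathbb R^d)$ satisfy $\int_{\mathcal K}\varpi\boldsymbol f\boldsymbol f^\top d\tau\succ0$; put $F(\tau)=\boldsymbol f(\tau)\otimes I_n$, $\mathsf F^{-1}=\int_{\mathcal K}\varpi\boldsymbol f\boldsymbol f^\top d\tau$. For $\boldsymbol x\in\mathcal L^2_\varpi(\mathcal K;\mathbb R^n)$ consider the three lower bounds of $\int_{\mathcal K}\varpi\boldsymbol x^\top U\boldsymbol x\,d\tau$: (I) $\int_{\mathcal K}\varpi\boldsymbol x^\top F^\top d\tau\,(\mathsf F\otimes U)\int_{\mathcal K}\varpi F\boldsymbol x\,d\tau$; (II) $\boldsymbol\zeta^\top[\mathsf{Sy}(H^\top\Omega)-H^\top(\mathsf F^{-1}\otimes U^{-1})H]\boldsymbol\zeta$ with $H\in\mathbb R^{dn\times\nu}$, where $\Omega\in\mathbb R^{dn\times\nu}$, $\boldsymbol\zeta\in\mathbb R^\nu$ satisfy $\Omega\boldsymbol\zeta=\int_{\mathcal K}\varpi F\boldsymbol x\,d\tau$; (III) $\boldsymbol z^\top[\mathsf{Sy}(\Upsilon^\top\widehat X)-\mathsf W]\boldsymbol z$, where $\Upsilon\in\mathbb R^{dn\times\rho n}$, $\boldsymbol z\in\mathbb R^{\rho n}$ ($\rho\in\mathbb N$) satisfy $\Upsilon\boldsymbol z=\int_{\mathcal K}\varpi F\boldsymbol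 x\,d\tau$, and $Y\in\mathbb S^{\rho dn}$, $X=[X_1\cdots X_d]\in\mathbb R^{n\times\rho dn}$ ($X_i\in\mathbb R^{n\times\rho n}$) satisfy $$\begin{bmatrix}U&-X\\ -X^\top&Y\end{bmatrix}\succeq0,\tag{$\star$}$$ with $\widehat X$ the vertical stacking of $X_1,\dots,X_d$ and $\mathsf W=\int_{\mathcal K}\varpi(\tau)(\boldsymbol f^\top(\tau)\otimes I_{\rho n})Y(\boldsymbol f(\tau)\otimes I_{\rho n})d\tau$. Then it is always possible to construct $X$ and $Y$ satisfying $(\star)$ such that (III) becomes (I). In addition, the maximum value of (III) (over $X,Y$ satisfying $(\star)$) is identical to the maximum value of (II) (over $H$), which in turn equals the value of (I).
   Context: $\mathcal K\subseteq\mathbb R\cup\{\pm\infty\}$ has nonzero Lebesgue measure; $\varpi:\mathcal K\to\mathbb R_{\ge0}$ is measurable with only finitely or countably infinitely many zeros. $\mathcal L^2_\varpi(\mathcal K;\mathbb R^d)$ is the set of measurable $\boldsymbol\phi:\mathcal K\to\mathbb R^d$ with $\int_{\mathcal K}\varpi\boldsymbol\phi^\top\boldsymbol\phi\,d\tau<\infty$. $\mathsf{Sy}(X)=X+X^\top$; $\otimes$: Kronecker product; $\mathbb S^n$: real symmetric matrices, $\mathbb S^n_{\succ0}$ the positive definite ones. *)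

(* Defs.v *)
From HB Require Import structures.
From mathcomp Require Import all_boot all_order all_algebra.
From mathcomp Require Export mxtens.
From mathcomp Require Import all_classical all_reals all_analysis.

Set Implicit Arguments.
Unset Strict Implicit.
Unset Printing Implicit Defensive.

Import Order.TTheory GRing.Theory Num.Theory.
Import numFieldNormedType.Exports.
Local Open Scope classical_set_scope.
Local Open Scope ring_scope.

(* The real line with the sigma-algebra of Lebesgue (not only Borel) measurable
   sets, i.e. the domain of [completed_lebesgue_measure]. *)
Definition lebesgueTypeR (R : realType) :=
  caratheodory_type ((@wlength R idfun)^*)%mu.

(* Sets and functions live on the extended real line [\bar R].  Since {-oo, +oo}
   is Lebesgue null, measure, measurability and integrals over [K] are those of
   the finite part of [K].  Functions on [K] are total functions on [\bar R] of
   which only the values on [K] matter. *)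
Definition fin_part (R : realType) (K : set (\bar R)) : set (lebesgueTypeR R) :=
  [set t : lebesgueTypeR R | K (t : R)%:E].

Definition lebesgue_measurable (R : realType) (K : set (\bar R)) : Prop :=
  measurable (fin_part K).

Definition lebesgue_size (R : realType) (K : set (\bar R)) : \bar R :=
  completed_lebesgue_measure (fin_part K).

Definition lebesgue_measurable_fun (R : realType) (K : set (\bar R))
    (g : \bar R -> R) : Prop :=
  measurable_fun (fin_part K) (fun t : lebesgueTypeR R => g (t : R)%:E).

Definition integral_on (R : realType) (K : set (\bar R)) (g : \bar R -> R) :
    \bar R :=
  (\int[completed_lebesgue_measure]_(t in fin_part K) (g (t : R)%:E)%:E)%E.

Definition mx_integral (R : realType) (m n : nat) (K : set (\bar R))
    (G : \bar R -> 'M[R]_(m, n)) : 'M[R]_(m, n) :=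
  \matrix_(i, j) fine (integral_on K (fun t => G t i j)).

Definition is_weight (R : realType) (K : set (\bar R)) (w : \bar R -> R) : Prop :=
  [/\ forall t, K t -> 0 <= w t,
      lebesgue_measurable_fun K w
    & countable [set t | K t /\ w t = 0]].

Definition L2w (R : realType) (K : set (\bar R)) (w : \bar R -> R) (d : nat) :
    set (\bar R -> 'cV[R]_d) :=
  [set phi : \bar R -> 'cV[R]_d |
    (forall i, lebesgue_measurable_fun K (fun t => phi t i 0)) /\
    (integral_on K (fun t => w t * ((phi t)^T *m phi t) 0 0)%R < +oo)%E].

Definition posdef (R : realType) (n : nat) (A : 'M[R]_n) : Prop :=
  A^T = A /\ forall v : 'cV[R]_n, v != 0 -> 0 < (v^T *m A *m v) 0 0.

Definition possemidef (R : realType) (n : nat) (A : 'M[R]_n) : Prop :=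
  A^T = A /\ forall v : 'cV[R]_n, 0 <= (v^T *m A *m v) 0 0.

Definition Sy (R : realType) (n : nat) (A : 'M[R]_n) : 'M[R]_n := A + A^T.

(* The Kronecker product of a column [a] with the identity matrix of order [k];
   the cast only turns the number of columns [1 * k] into [k]. *)
Definition kron1 (R : realType) (d k : nat) (a : 'cV[R]_d) : 'M[R]_(d * k, k) :=
  castmx (erefl _, mul1n k) (a *t (1%:M : 'M[R]_k)).
Arguments kron1 {R d} k a.

Definition gram (R : realType) (K : set (\bar R)) (w : \bar R -> R) (d : nat)
    (f : \bar R -> 'cV[R]_d) : 'M[R]_d :=
  mx_integral K (fun t => w t *: (f t *m (f t)^T)).

Definition moment (R : realType) (K : set (\bar R)) (w : \bar R -> R) (d n : nat)
    (f : \bar R -> 'cV[R]_d) (x : \bar R -> 'cV[R]_n) : 'cV[R]_(d * n) :=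
  mx_integral K (fun t => w t *: (kron1 n (f t) *m x t)).

Definition bound_gram (R : realType) (K : set (\bar R)) (w : \bar R -> R)
    (d n : nat) (f : \bar R -> 'cV[R]_d) (U : 'M[R]_n)
    (x : \bar R -> 'cV[R]_n) : R :=
  (mx_integral K (fun t => w t *: ((x t)^T *m (kron1 n (f t))^T))
     *m (invmx (gram K w f) *t U) *m moment K w f x) 0 0.

Definition bound_free (R : realType) (K : set (\bar R)) (w : \bar R -> R)
    (d n nu : nat) (f : \bar R -> 'cV[R]_d) (U : 'M[R]_n)
    (Omega : 'M[R]_(d * n, nu)) (zeta : 'cV[R]_nu)
    (H : 'M[R]_(d * n, nu)) : R :=
  (zeta^T *m (Sy (H^T *m Omega) - H^T *m (gram K w f *t invmx U) *m H)
     *m zeta) 0 0.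

(* A matrix with [d * m] columns is a row [X_0 ... X_(d-1)] of [d] blocks with
   [m] columns each; column [b] of [X_i] has index [mxtens_index (i, b)], whose
   value is [i * m + b].  [vstack X] stacks the blocks vertically. *)
Definition col_block (R : realType) (n d m : nat) (X : 'M[R]_(n, d * m))
    (i : 'I_d) : 'M[R]_(n, m) :=
  \matrix_(a, b) X a (mxtens_index (i, b)).

Definition vstack (R : realType) (n d m : nat) (X : 'M[R]_(n, d * m)) :
    'M[R]_(d * n, m) :=
  \matrix_(r, b) col_block X (mxtens_unindex r).1 (mxtens_unindex r).2 b.

Definition slack_lmi (R : realType) (n m : nat) (U : 'M[R]_n)
    (X : 'M[R]_(n, m)) (Y : 'M[R]_m) : Prop :=
  Y^T = Y /\ possemidef (block_mx U (- X) (- X^T) Y).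

Definition slack_weight (R : realType) (K : set (\bar R)) (w : \bar R -> R)
    (d m : nat) (f : \bar R -> 'cV[R]_d) (Y : 'M[R]_(d * m)) : 'M[R]_m :=
  mx_integral K (fun t => w t *: ((kron1 m (f t))^T *m Y *m kron1 m (f t))).

Definition bound_slack (R : realType) (K : set (\bar R)) (w : \bar R -> R)
    (d n rho : nat) (f : \bar R -> 'cV[R]_d)
    (Upsilon : 'M[R]_(d * n, rho * n)) (z : 'cV[R]_(rho * n))
    (X : 'M[R]_(n, d * (rho * n))) (Y : 'M[R]_(d * (rho * n))) : R :=
  (z^T *m (Sy (Upsilon^T *m vstack X) - slack_weight K w f Y) *m z) 0 0.

Definition is_maximum (R : realType) (A : set R) (m : R) : Prop :=
  A m /\ ubound A m.

(* Main.v *)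
Require Import Defs.
From HB Require Import structures.
From mathcomp Require Import all_boot all_order all_algebra.
From mathcomp Require Import all_classical all_reals all_analysis.
From mathcomp Require Import measurable_realfun lra.

Import Order.TTheory GRing.Theory Num.Theory.
Import numFieldNormedType.Exports.
Local Open Scope classical_set_scope.
Local Open Scope ring_scope.

(** Write m for the moment of x against f, G for the Gram matrix of f, and
    P = G^-1 *t U, Q = G *t U^-1, which are inverse to each other.  The free
    bound evaluated at H is u^T m + m^T u - u^T Q u with u = H zeta, a concave
    quadratic in u.  Completing the square ([complete_square]) gives

      m^T P m - (u^T m + m^T u - u^T Q u) = (P m - u)^T Q (P m - u) >= 0,

    so the free bound never exceeds m^T P m, the Gram bound, and H = P Omega
    attains it for every zeta ([bound_free_le_gram], [bound_free_opt]).

    The slack bound reduces to the free one by a Schur complement.  With X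
    given, the matrix inequality says that Y dominates X^T U^-1 X, and enlarging
    Y only lowers the slack bound ([schur_complement], [bound_slack_le]).  For
    Y = X^T U^-1 X, writing F = f *t I, the commutation
    X (f *t I) = F^T (vstack X) turns the integral of the slack weight into
    (vstack X)^T Q (vstack X), because F U^-1 F^T = (f f^T) *t U^-1; hence the
    slack bound of X is then exactly the free bound of H = vstack X
    ([bound_slack_schur]).  Since every H is vstack X for some X, both maxima
    are the Gram bound, and vstack X = P Upsilon gives the slack maximiser,
    which depends on Upsilon only.

    The energy dominates the Gram bound by the pointwise Fenchel-Young
    inequality
      x^T v + v^T x - x^T U x <= v^T U^-1 v   with v = F^T p,
    multiplied by the weight and integrated: the result is that the energy is at
    least p^T m + m^T p - p^T Q p for every vector p, and p = P m makes the
    latter the Gram bound ([bound_gram_le_energy]).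

    All integrals exist because the weighted product of two coordinates of
    square-integrable functions is integrable ([L2w_integrable_outer]); every
    matrix integral that occurs is then a linear image of integrals of the outer
    products f f^T, f x^T and x x^T. *)

Set Implicit Arguments.
Unset Strict Implicit.
Unset Printing Implicit Defensive.

(** * Completing the square *)

Lemma complete_square (R : realType) (n : nat) (P Q : 'M[R]_n) (m u : 'cV[R]_n) :
  P^T = P -> Q^T = Q -> Q *m P = 1%:M ->
  m^T *m P *m m - (u^T *m m + m^T *m u - u^T *m Q *m u) =
  (P *m m - u)^T *m Q *m (P *m m - u).
Proof.
move=> PT QT QP; have PQ := mulmx1C QP.
rewrite [(P *m m - u)^T]linearB /= trmx_mul PT !mulmxBl !mulmxBr !mulmxA.
rewrite -(mulmxA m^T P Q) PQ mulmx1 -(mulmxA u^T Q P) QP mulmx1.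
by rewrite -[RHS]addrA -opprD; congr (_ - _); rewrite addrA [in RHS](addrC (m^T *m u)).
Qed.

Lemma posdef_unitmx (R : realType) (n : nat) (A : 'M[R]_n) :
  posdef A -> A \in unitmx.
Proof.
move=> [_ A0]; rewrite -row_free_unit -kermx_eq0.
apply/eqP/eqP/rowV0P => v /sub_kermxP vA0; apply/eqP/negPn/negP => v0.
have := A0 v^T; rewrite -(inj_eq trmx_inj) trmxK trmx0 vA0 mul0mx mxE ltxx.
by move=> /(_ v0).
Qed.

Lemma posdef_possemidef (R : realType) (n : nat) (A : 'M[R]_n) :
  posdef A -> possemidef A.
Proof.
move=> [AT A0]; split=> // v; have [->|v0] := eqVneq v 0; last exact/ltW/A0.
by rewrite mulmx0 mxE.
Qed.

Lemma posdef_inv (R : realType) (n : nat) (A : 'M[R]_n) :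
  posdef A -> possemidef (invmx A).
Proof.
move=> Apd; have uA := posdef_unitmx Apd; have [AT A0] := posdef_possemidef Apd.
split=> [|v]; first by rewrite trmx_inv AT.
have := A0 (invmx A *m v).
by rewrite trmx_mul trmx_inv AT !mulmxA mulmxKV.
Qed.

(** Fenchel's inequality for the conjugate pair of quadratic forms of [U] and
    its inverse: what is missing for equality is a completed square. *)
Lemma fenchel_young (R : realType) (n : nat) (U : 'M[R]_n) (m u : 'cV[R]_n) :
  posdef U ->
  (u^T *m m + m^T *m u - u^T *m U *m u) 0 0 <= (m^T *m invmx U *m m) 0 0.
Proof.
move=> Upd; have uU := posdef_unitmx Upd.
have [UT U0] := posdef_possemidef Upd.
rewrite -subr_ge0; have := U0 (invmx U *m m - u).
rewrite -complete_square ?mulmxV ?trmx_inv ?UT //.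
by rewrite [leRHS]mxE [X in _ + X]mxE.
Qed.

(** The off-diagonal part of the form pairs [a] with [X *m b] only, so it has
    the shape treated by [fenchel_young]. *)
Lemma block_form (R : realType) (n m : nat) (U : 'M[R]_n) (X : 'M[R]_(n, m))
    (Y : 'M[R]_m) (a : 'cV[R]_n) (b : 'cV[R]_m) :
  (col_mx a b)^T *m block_mx U (- X) (- X^T) Y *m col_mx a b =
  b^T *m Y *m b - (a^T *m (X *m b) + (X *m b)^T *m a - a^T *m U *m a).
Proof.
rewrite tr_col_mx mul_row_block mul_row_col !mulmxDl trmx_mul.
rewrite !mulmxN !mulNmx !mulmxA !opprD opprK !addrA.
by rewrite [LHS](ACl (4*3*2*1)).
Qed.

(** Only the half of the Schur complement criterion that eliminates the upper
    block: the form is tested at the vector whose upper part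
    [invmx U *m (X *m b)] minimises it for given [b]. *)
Lemma schur_complement (R : realType) (n m : nat) (U : 'M[R]_n)
    (X : 'M[R]_(n, m)) (Y : 'M[R]_m) (b : 'cV[R]_m) :
  posdef U -> slack_lmi U X Y ->
  (b^T *m (X^T *m invmx U *m X) *m b) 0 0 <= (b^T *m Y *m b) 0 0.
Proof.
move=> Upd [YT [_ /(_ (col_mx (invmx U *m (X *m b)) b))]].
rewrite block_form; have [UT _] := posdef_inv Upd.
rewrite mxE [X in _ + X]mxE subr_ge0; congr (_ <= _); congr (fun_of_matrix _ 0 0).
rewrite !trmx_mul UT !mulmxA mulmxKV ?posdef_unitmx //.
by rewrite addrK.
Qed.

(** The Schur complement itself is the smallest admissible slack matrix; the
    inequality for it is [fenchel_young] with [m := X *m b]. *)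
Lemma schur_lmi (R : realType) (n m : nat) (U : 'M[R]_n) (X : 'M[R]_(n, m)) :
  posdef U -> slack_lmi U X (X^T *m invmx U *m X).
Proof.
move=> Upd; have [UT _] := Upd; have [UiT _] := posdef_inv Upd.
have YT : (X^T *m invmx U *m X)^T = X^T *m invmx U *m X.
  by rewrite !trmx_mul trmxK UiT mulmxA.
split=> //; split=> [|v]; first by rewrite tr_block_mx UT YT !linearN /= trmxK.
rewrite -(vsubmxK v) block_form mxE [X in _ + X]mxE subr_ge0.
apply: le_trans (fenchel_young _ _ Upd) _.
by rewrite trmx_mul !mulmxA.
Qed.

(** Rewrites the gap between the weighted energy and its linear and quadratic
    corrections as a Fenchel-Young gap.  The left-hand side keeps [c] next to
    the blocks [F *m x] and [F *m V *m F^T], which are the quantities whose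
    integrals are known; the right-hand side is visibly nonnegative. *)
Lemma weighted_gap (R : realType) (n q : nat) (c : R) (U V : 'M[R]_n)
    (F : 'M[R]_(q, n)) (x : 'cV[R]_n) (p : 'cV[R]_q) :
  c *: (x^T *m U *m x) -
  (p^T *m (c *: (F *m x)) + (c *: (F *m x))^T *m p -
   p^T *m (c *: (F *m V *m F^T)) *m p) =
  c *: ((F^T *m p)^T *m V *m (F^T *m p) -
        (x^T *m (F^T *m p) + (F^T *m p)^T *m x - x^T *m U *m x)).
Proof.
rewrite [(c *: _)^T]linearZ /= !trmx_mul trmxK -!scalemxAr -!scalemxAl.
rewrite -scalerDr -!scalerBr !mulmxA; congr (_ *: _).
move: (x^T *m U *m x) (p^T *m F *m x) (x^T *m F^T *m p) => a b e.
by rewrite !opprD !opprK !addrA [LHS](ACl (4*3*2*1)).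
Qed.

(** * Kronecker products with a column vector *)

Lemma sum_mxtens (V : nmodType) (d n : nat) (E : 'I_(d * n) -> V) :
  \sum_r E r = \sum_i \sum_a E (mxtens_index (i, a)).
Proof.
rewrite (reindex (@mxtens_index d n)) /=; last first.
  by exists (@mxtens_unindex d n) => r _; rewrite (mxtens_indexK, mxtens_unindexK).
by rewrite pair_big; apply: eq_bigr => -[].
Qed.

Lemma tens_id (R : pzRingType) (d n : nat) :
  (1%:M : 'M[R]_d) *t (1%:M : 'M[R]_n) = 1%:M.
Proof.
apply/matrixP => r s.
case: (mxtens_indexP r) => i a; case: (mxtens_indexP s) => j b.
by rewrite tensmxE !mxE (can_eq (@mxtens_indexK d n)) xpair_eqE -natrM mulnb.
Qed.

Lemma kron1E (R : realType) (d k : nat) (f : 'cV[R]_d) i a (b : 'I_k) :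
  kron1 k f (mxtens_index (i, a)) b = f i 0 * (a == b)%:R.
Proof.
rewrite castmxE !mxE cast_ord_id mxtens_indexK /= [X in f i X]ord1.
by congr (_ * (_ == _)%:R); apply/val_inj; rewrite /= modn_small.
Qed.

Lemma mul_kron1E (R : realType) (d k p : nat) (f : 'cV[R]_d)
    (B : 'M[R]_(k, p)) i a b :
  (kron1 k f *m B) (mxtens_index (i, a)) b = f i 0 * B a b.
Proof.
rewrite mxE (bigD1 a) //= big1 ?addr0; first by rewrite kron1E eqxx mulr1.
by move=> c /negPf ca; rewrite kron1E eq_sym ca mulr0 mul0r.
Qed.

(** The mixed product rule: conjugating by [f *t 1] separates the dependence on
    [f] from that on the inner matrix, so that integrating over [f] leaves a
    Kronecker product with a Gram matrix. *)
Lemma kron1_conj (R : realType) (d k : nat) (f : 'cV[R]_d) (V : 'M[R]_k) :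
  kron1 k f *m V *m (kron1 k f)^T = (f *m f^T) *t V.
Proof.
apply/matrixP => r s.
case: (mxtens_indexP r) => i a; case: (mxtens_indexP s) => j b.
rewrite tensmxE -[_ *m (kron1 k f)^T]trmxK trmx_mul trmxK mxE mul_kron1E.
by rewrite [in LHS]mxE mul_kron1E mxE big_ord1 mxE mulrA (mulrC (f j 0)).
Qed.

(** Both sides are the combination of the blocks of [X] with the coordinates of
    [f] as coefficients.  This links the two roles of [X] in the slack bound. *)
Lemma tr_kron1_vstack (R : realType) (d n m : nat) (f : 'cV[R]_d)
    (X : 'M[R]_(n, d * m)) :
  (kron1 n f)^T *m vstack X = X *m kron1 m f.
Proof.
apply/matrixP => a b; rewrite !mxE !sum_mxtens; apply: eq_bigr => i _.
rewrite (bigD1 a) //= big1 ?addr0; last first.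
  by move=> c /negPf ca; rewrite mxE kron1E ca mulr0 mul0r.
rewrite [RHS](bigD1 b) //= [X in _ = _ + X]big1 ?addr0; last first.
  by move=> c /negPf ca; rewrite kron1E ca !mulr0.
by rewrite mxE !kron1E !eqxx !mulr1 !mxE mxtens_indexK mulrC.
Qed.

(** [vstack] merely rearranges entries, so any target can be reached; this lets
    a maximiser of the free bound be turned into slack variables. *)
Lemma vstack_surj (R : realType) (n d m : nat) (M : 'M[R]_(d * n, m)) :
  exists X : 'M[R]_(n, d * m), vstack X = M.
Proof.
exists (\matrix_(a, q)
  M (mxtens_index ((mxtens_unindex q).1, a)) (mxtens_unindex q).2).
apply/matrixP => r b; case: (mxtens_indexP r) => i a.
by rewrite !mxE !mxtens_indexK.
Qed.

(** The inverse relation is stated as an equation rather than through [invmx]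
    of a Kronecker product, so that no dimension has to be positive. *)
Lemma tens_mulV (R : realType) (d n : nat) (G : 'M[R]_d) (U : 'M[R]_n) :
  posdef G -> posdef U -> (G *t invmx U) *m (invmx G *t U) = 1%:M.
Proof.
move=> /posdef_unitmx uG /posdef_unitmx uU.
by rewrite tensmx_mul mulmxV // mulVmx // tens_id.
Qed.

(** * Integrals of matrix-valued functions *)

Definition integrable_on (R : realType) (K : set (\bar R)) (g : \bar R -> R) : Prop :=
  (@completed_lebesgue_measure R).-integrable (fin_part K)
    (fun t : lebesgueTypeR R => (g (t : R)%:E)%:E).

(** Existence and value of the integral in one predicate: since [fine] gives a
    value to every integral, the value alone would not allow linear
    manipulations, while the pair is stable under them. *)
Definition has_mx_integral (R : realType) (K : set (\bar R)) (m n : nat)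
    (G : \bar R -> 'M[R]_(m, n)) (V : 'M[R]_(m, n)) : Prop :=
  (forall i j, integrable_on K (fun t => G t i j)) /\ mx_integral K G = V.

Lemma integral_on_eq (R : realType) (K : set (\bar R)) (g h : \bar R -> R) :
  (forall t, K t -> g t = h t) -> integral_on K g = integral_on K h.
Proof.
by move=> gh; apply: eq_integral => t; rewrite inE => Kt; rewrite gh.
Qed.

Lemma integrable_on_eq (R : realType) (K : set (\bar R)) (g h : \bar R -> R) :
  lebesgue_measurable K ->
  (forall t, K t -> g t = h t) -> integrable_on K g -> integrable_on K h.
Proof.
move=> mK gh ig; apply: (eq_integrable mK _ _ _ ig) => t /=.
by rewrite inE => Kt; rewrite gh.
Qed.

Lemma has_mx_integral_eq (R : realType) (K : set (\bar R)) (m n : nat)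
    (G H : \bar R -> 'M[R]_(m, n)) (V : 'M[R]_(m, n)) :
  lebesgue_measurable K -> (forall t, K t -> G t = H t) ->
  has_mx_integral K G V -> has_mx_integral K H V.
Proof.
move=> mK GH [iG <-]; split=> [i j|].
  by apply: integrable_on_eq (iG i j) => // t Kt; rewrite GH.
apply/matrixP => i j; rewrite !mxE; congr fine; apply: integral_on_eq => t Kt.
by rewrite GH.
Qed.

Lemma has_mx_integralD (R : realType) (K : set (\bar R)) (m n : nat)
    (G H : \bar R -> 'M[R]_(m, n)) (V W : 'M[R]_(m, n)) :
  lebesgue_measurable K ->
  has_mx_integral K G V -> has_mx_integral K H W ->
  has_mx_integral K (fun t => G t + H t) (V + W).
Proof.
move=> mK [iG <-] [iH <-].
have E i j t : K t -> G t i j + H t i j = (G t + H t) i j by rewrite mxE.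
split=> [i j|].
  apply: (integrable_on_eq mK (E i j) _).
  exact: (integrableD mK (iG i j) (iH i j)).
apply/matrixP => i j; rewrite !mxE -(integral_on_eq (E i j)).
exact: (RintegralD mK (iG i j) (iH i j)).
Qed.

(** Linearity for explicit coefficients, in the form in which it appears in the
    entries of a matrix product. *)
Lemma integral_on_sum (R : realType) (K : set (\bar R)) (I : Type) (s : seq I)
    (c : I -> R) (g : I -> \bar R -> R) :
  lebesgue_measurable K -> (forall i, integrable_on K (g i)) ->
  integrable_on K (fun t => \sum_(i <- s) c i * g i t) /\
  fine (integral_on K (fun t => \sum_(i <- s) c i * g i t)) =
  \sum_(i <- s) c i * fine (integral_on K (g i)).
Proof.
move=> mK ig; elim: s => [|i s [IHi IHv]].
  have g0 t : K t -> 0 = \sum_(i <- [::]) c i * g i t by rewrite big_nil.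
  split; first by apply: (integrable_on_eq mK g0 _); exact: integrable0.
  by rewrite -(integral_on_eq g0) big_nil /integral_on integral0.
have gS t : K t -> c i * g i t + \sum_(j <- s) c j * g j t =
    \sum_(j <- i :: s) c j * g j t by rewrite big_cons.
have iZ : integrable_on K (fun t => c i * g i t).
  exact: (integrableZl mK (c i) (ig i)).
split; first by apply: (integrable_on_eq mK gS _); exact: (integrableD mK iZ IHi).
rewrite -(integral_on_eq gS) big_cons -IHv.
have := RintegralD mK iZ IHi; rewrite (RintegralZl _ mK (ig i)).
exact.
Qed.

Lemma has_mx_integralMl (R : realType) (K : set (\bar R)) (m n p : nat)
    (A : 'M[R]_(m, n)) (G : \bar R -> 'M[R]_(n, p)) (V : 'M[R]_(n, p)) :
  lebesgue_measurable K -> has_mx_integral K G V ->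
  has_mx_integral K (fun t => A *m G t) (A *m V).
Proof.
move=> mK [iG <-].
pose S i j := integral_on_sum (index_enum _) (fun k => A i k) mK (iG^~ j).
have E i j t : K t -> \sum_k A i k * G t k j = (A *m G t) i j by rewrite mxE.
split=> [i j|]; first by apply: (integrable_on_eq mK (E i j) _); case: (S i j).
apply/matrixP => i j; rewrite !mxE -(integral_on_eq (E i j)).
by rewrite (S i j).2; apply: eq_bigr => k _; rewrite mxE.
Qed.

Lemma has_mx_integralT (R : realType) (K : set (\bar R)) (m n : nat)
    (G : \bar R -> 'M[R]_(m, n)) (V : 'M[R]_(m, n)) :
  lebesgue_measurable K -> has_mx_integral K G V ->
  has_mx_integral K (fun t => (G t)^T) V^T.
Proof.
move=> mK [iG <-].
have E i j t : K t -> G t j i = (G t)^T i j by rewrite mxE.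
split=> [i j|]; first exact: (integrable_on_eq mK (E i j) (iG _ _)).
by apply/matrixP => i j; rewrite !mxE -(integral_on_eq (E i j)).
Qed.

Lemma has_mx_integralMr (R : realType) (K : set (\bar R)) (m n p : nat)
    (A : 'M[R]_(n, p)) (G : \bar R -> 'M[R]_(m, n)) (V : 'M[R]_(m, n)) :
  lebesgue_measurable K -> has_mx_integral K G V ->
  has_mx_integral K (fun t => G t *m A) (V *m A).
Proof.
move=> mK /(has_mx_integralT mK)/(has_mx_integralMl A^T mK).
move=> /(has_mx_integralT mK); rewrite trmx_mul !trmxK.
by apply: has_mx_integral_eq => // t _; rewrite trmx_mul !trmxK.
Qed.

Lemma has_mx_integralN (R : realType) (K : set (\bar R)) (m n : nat)
    (G : \bar R -> 'M[R]_(m, n)) (V : 'M[R]_(m, n)) :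
  lebesgue_measurable K -> has_mx_integral K G V ->
  has_mx_integral K (fun t => - G t) (- V).
Proof.
move=> mK /(has_mx_integralMl (- 1%:M) mK); rewrite mulNmx mul1mx.
by apply: has_mx_integral_eq => // t _; rewrite mulNmx mul1mx.
Qed.

Lemma has_mx_integral_tens (R : realType) (K : set (\bar R)) (m n p q : nat)
    (G : \bar R -> 'M[R]_(m, n)) (V : 'M[R]_(m, n)) (B : 'M[R]_(p, q)) :
  lebesgue_measurable K -> has_mx_integral K G V ->
  has_mx_integral K (fun t => G t *t B) (V *t B).
Proof.
move=> mK [iG <-].
have E i a j b t : K t -> B a b * G t i j =
    (G t *t B) (mxtens_index (i, a)) (mxtens_index (j, b)).
  by rewrite tensmxE mulrC.
split=> [r s|]; last apply/matrixP => r s.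
  case: (mxtens_indexP r) => i a; case: (mxtens_indexP s) => j b.
  apply: (integrable_on_eq mK (E i a j b) _).
  exact: (integrableZl mK _ (iG i j)).
case: (mxtens_indexP r) => i a; case: (mxtens_indexP s) => j b.
rewrite tensmxE !mxE -(integral_on_eq (E i a j b)) [RHS]mulrC.
exact: (RintegralZl _ mK (iG i j)).
Qed.

Lemma has_mx_integral_trace (R : realType) (K : set (\bar R)) (n : nat)
    (G : \bar R -> 'M[R]_n) (V : 'M[R]_n) :
  lebesgue_measurable K -> has_mx_integral K G V ->
  integrable_on K (fun t => \tr (G t)).
Proof.
move=> mK [iG _].
have [+ _] := integral_on_sum (index_enum _) (fun=> 1) mK (fun i => iG i i).
by apply: integrable_on_eq => // t _; apply: eq_bigr => i _; rewrite mul1r.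
Qed.

Lemma has_mx_integral_ge0 (R : realType) (K : set (\bar R))
    (G : \bar R -> 'M[R]_1) (V : 'M[R]_1) :
  has_mx_integral K G V -> (forall t, K t -> 0 <= G t 0 0) -> 0 <= V 0 0.
Proof.
by move=> [_ <-] G0; rewrite mxE; apply: Rintegral_ge0 => t Kt; apply: G0.
Qed.

(** * Products of square-integrable functions *)

Lemma dotE (R : realType) (d : nat) (v : 'cV[R]_d) :
  (v^T *m v) 0 0 = \sum_i v i 0 ^+ 2.
Proof. by rewrite mxE; apply: eq_bigr => i _; rewrite mxE. Qed.

(** Combines |ab| <= a^2 + b^2 with the fact that a squared coordinate is at
    most the squared norm. *)
Lemma coord_mul_le (R : realType) (d n : nat) (u : 'cV[R]_d) (v : 'cV[R]_n) i j :
  `|u i 0 * v j 0| <= (u^T *m u) 0 0 + (v^T *m v) 0 0.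
Proof.
have le_dot m (x : 'cV[R]_m) k : x k 0 ^+ 2 <= (x^T *m x) 0 0.
  by rewrite dotE (bigD1 k) //= lerDl sumr_ge0 // => l _; exact: sqr_ge0.
apply: le_trans (lerD (le_dot _ u i) (le_dot _ v j)).
by rewrite ler_norml; apply/andP; split; nra.
Qed.

Lemma L2w_integrable_dot (R : realType) (K : set (\bar R)) (w : \bar R -> R)
    (d : nat) (u : \bar R -> 'cV[R]_d) :
  lebesgue_measurable K -> is_weight K w -> L2w K w u ->
  integrable_on K (fun t => w t * ((u t)^T *m u t) 0 0).
Proof.
move=> mK [w0 mw _] [mu fin_u]; apply/integrableP; split.
  have mdot : lebesgue_measurable_fun K (fun t => ((u t)^T *m u t) 0 0).
    rewrite /lebesgue_measurable_fun; under eq_fun do rewrite dotE.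
    by apply: measurable_sum => i; apply: measurable_funX; exact: mu.
  by have /measurable_EFinP := measurable_funM mw mdot; exact.
rewrite (eq_integral (fun t : lebesgueTypeR R =>
  (w (t : R)%:E * ((u (t : R)%:E)^T *m u (t : R)%:E) 0 0)%:E)) // => t.
rewrite inE => Kt; rewrite gee0_abs // lee_fin mulr_ge0 ?w0 // dotE.
by rewrite sumr_ge0 // => i _; exact: sqr_ge0.
Qed.

(** Dominated by the sum of the two weighted squared norms, by
    [coord_mul_le]. *)
Lemma L2w_integrable_outer (R : realType) (K : set (\bar R)) (w : \bar R -> R)
    (d n : nat) (u : \bar R -> 'cV[R]_d) (v : \bar R -> 'cV[R]_n) i j :
  lebesgue_measurable K -> is_weight K w -> L2w K w u -> L2w K w v ->
  integrable_on K (fun t => w t * (u t i 0 * v t j 0)).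
Proof.
move=> mK ww u2 v2; have [w0 mw _] := ww.
have iu := L2w_integrable_dot mK ww u2; have iv := L2w_integrable_dot mK ww v2.
apply: (le_integrable mK _ _ (integrableD mK iu iv)).
  have := measurable_funM mw (measurable_funM (u2.1 i) (v2.1 j)).
  by move=> /measurable_EFinP; exact.
move=> t Kt /=; rewrite lee_fin -mulrDr !normrM (ger0_norm (w0 _ Kt)) -normrM.
apply: (ler_wpM2l (w0 _ Kt)).
exact: le_trans (coord_mul_le _ _ _ _) (ler_norm _).
Qed.

Lemma L2w_outer (R : realType) (K : set (\bar R)) (w : \bar R -> R)
    (d n : nat) (u : \bar R -> 'cV[R]_d) (v : \bar R -> 'cV[R]_n) :
  lebesgue_measurable K -> is_weight K w -> L2w K w u -> L2w K w v ->
  let G := fun t => w t *: (u t *m (v t)^T) in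
  has_mx_integral K G (mx_integral K G).
Proof.
move=> mK ww u2 v2; split=> // i j.
apply: (integrable_on_eq mK _ (L2w_integrable_outer i j mK ww u2 v2)) => t _.
by rewrite mxE mxE big_ord1 mxE.
Qed.

Lemma moment_integral (R : realType) (K : set (\bar R)) (w : \bar R -> R)
    (d n : nat) (f : \bar R -> 'cV[R]_d) (x : \bar R -> 'cV[R]_n) :
  lebesgue_measurable K -> is_weight K w -> L2w K w f -> L2w K w x ->
  has_mx_integral K (fun t => w t *: (kron1 n (f t) *m x t)) (moment K w f x).
Proof.
move=> mK ww f2 x2; split=> // r j; case: (mxtens_indexP r) => i a.
apply: (integrable_on_eq mK _ (L2w_integrable_outer i a mK ww f2 x2)) => t _.
by rewrite mxE mul_kron1E [j]ord1.
Qed.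

Lemma kron1_conj_integral (R : realType) (K : set (\bar R)) (w : \bar R -> R)
    (d k : nat) (f : \bar R -> 'cV[R]_d) (V : 'M[R]_k) :
  lebesgue_measurable K -> is_weight K w -> L2w K w f ->
  has_mx_integral K (fun t => w t *: (kron1 k (f t) *m V *m (kron1 k (f t))^T))
    (gram K w f *t V).
Proof.
move=> mK ww f2.
apply: has_mx_integral_eq (has_mx_integral_tens V mK (L2w_outer mK ww f2 f2)) => //.
move=> t _; rewrite kron1_conj.
by apply/matrixP => r s; rewrite !mxE mulrA.
Qed.

(** The entry (a, b) of F^T Y F is the trace of Y F E F^T with E the matrix unit
    at (b, a), and [kron1_conj_integral] covers F E F^T; this avoids expanding
    the double sum over the blocks of [Y]. *)
Lemma slack_weight_integral (R : realType) (K : set (\bar R)) (w : \bar R -> R)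
    (d m : nat) (f : \bar R -> 'cV[R]_d) (Y : 'M[R]_(d * m)) :
  lebesgue_measurable K -> is_weight K w -> L2w K w f ->
  has_mx_integral K
    (fun t => w t *: ((kron1 m (f t))^T *m Y *m kron1 m (f t)))
    (slack_weight K w f Y).
Proof.
move=> mK ww f2; split=> // a b.
have := kron1_conj_integral (delta_mx b a) mK ww f2.
move=> /(has_mx_integralMl Y mK)/(has_mx_integral_trace mK).
apply: (integrable_on_eq mK) => t _.
rewrite -scalemxAr linearZ /= mxE; congr (_ * _).
set F := kron1 m (f t).
rewrite -(mul_delta_mx (0 : 'I_1)) !mulmxA -(mulmxA _ _ F^T) mxtrace_mulC.
rewrite /mxtrace big_ord1 !mulmxA.
have -> : delta_mx 0 a *m F^T *m Y *m F *m delta_mx b (0 : 'I_1) =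
  col b (row a (F^T *m Y *m F)) by rewrite colE rowE !mulmxA.
by rewrite mxE mxE.
Qed.

(** * The three bounds *)

Section Bounds.

Variables (R : realType) (K : set (\bar R)) (w : \bar R -> R)
    (d n : nat) (U : 'M[R]_n) (f : \bar R -> 'cV[R]_d).
Hypotheses (mK : lebesgue_measurable K) (ww : is_weight K w)
    (Upd : posdef U) (f2 : L2w K w f) (Gpd : posdef (gram K w f)).

(** The free bound depends on [H] and [Omega] only through [H *m zeta] and
    [Omega *m zeta]. *)
Lemma bound_freeE (nu : nat) (Omega H : 'M[R]_(d * n, nu)) (zeta : 'cV[R]_nu) :
  bound_free K w f U Omega zeta H =
  ((H *m zeta)^T *m (Omega *m zeta) + (Omega *m zeta)^T *m (H *m zeta)
   - (H *m zeta)^T *m (gram K w f *t invmx U) *m (H *m zeta)) 0 0.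
Proof.
congr (fun_of_matrix _ 0 0).
by rewrite /Sy !trmx_mul trmxK mulmxBr mulmxBl mulmxDr mulmxDl !mulmxA.
Qed.

Lemma bound_gramE (x : \bar R -> 'cV[R]_n) :
  L2w K w x ->
  bound_gram K w f U x =
  ((moment K w f x)^T *m (invmx (gram K w f) *t U) *m moment K w f x) 0 0.
Proof.
move=> x2; congr (fun_of_matrix (_ *m _ *m _) 0 0).
have [_ <-] := has_mx_integralT mK (moment_integral mK ww f2 x2).
apply/matrixP => i j; rewrite !mxE; congr fine.
by apply: integral_on_eq => t _; rewrite linearZ /= trmx_mul.
Qed.

(** The Kronecker product is the weighted integral of F U^-1 F^T, whose values
    are positive semidefinite. *)
Lemma gram_tens_psd : possemidef (gram K w f *t invmx U).
Proof.
have [UT U0] := posdef_inv Upd; have [GT _] := Gpd.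
split=> [|v]; first by rewrite trmx_tens GT UT.
have := kron1_conj_integral (invmx U) mK ww f2.
move=> /(has_mx_integralMl v^T mK)/(has_mx_integralMr v mK) I.
apply: (has_mx_integral_ge0 I) => t Kt.
rewrite -scalemxAr -scalemxAl mxE mulr_ge0 //; first by case: ww => w0 _ _; exact: w0.
by have := U0 ((kron1 n (f t))^T *m v); rewrite trmx_mul trmxK !mulmxA.
Qed.

Lemma bound_free_le_gram (x : \bar R -> 'cV[R]_n) (nu : nat)
    (Omega H : 'M[R]_(d * n, nu)) (zeta : 'cV[R]_nu) :
  L2w K w x -> Omega *m zeta = moment K w f x ->
  bound_free K w f U Omega zeta H <= bound_gram K w f U x.
Proof.
move=> x2 Oz; rewrite bound_freeE bound_gramE // Oz -subr_ge0.
have [QT Q0] := gram_tens_psd.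
have [GT _] := posdef_inv Gpd; have [UT _] := Upd.
have := Q0 ((invmx (gram K w f) *t U) *m moment K w f x - H *m zeta).
rewrite -complete_square ?tens_mulV ?trmx_tens ?GT ?UT -?trmx_tens ?QT //.
by rewrite [leRHS]mxE [X in _ + X]mxE.
Qed.

(** The choice of [H] makes [H *m zeta] the maximiser P m of the concave
    quadratic, uniformly in [zeta]. *)
Lemma bound_free_opt (x : \bar R -> 'cV[R]_n) (nu : nat)
    (Omega : 'M[R]_(d * n, nu)) (zeta : 'cV[R]_nu) :
  L2w K w x -> Omega *m zeta = moment K w f x ->
  bound_free K w f U Omega zeta ((invmx (gram K w f) *t U) *m Omega) =
  bound_gram K w f U x.
Proof.
move=> x2 Oz; set P := invmx _ *t U; set m := moment K w f x in Oz *.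
have Hz : P *m Omega *m zeta = P *m m by rewrite -mulmxA Oz.
have QP : gram K w f *t invmx U *m (P *m m) = m.
  by rewrite mulmxA tens_mulV // mul1mx.
rewrite bound_freeE bound_gramE // Hz Oz -(mulmxA _ (_ *t _)) QP.
by rewrite [X in X - _]addrC addrK mulmxA.
Qed.

(** The integrand is the trace of [U] times the weighted outer product of [x]
    with itself. *)
Lemma energy_integrable (x : \bar R -> 'cV[R]_n) :
  L2w K w x -> has_mx_integral K (fun t => w t *: ((x t)^T *m U *m x t))
     (mx_integral K (fun t => w t *: ((x t)^T *m U *m x t))).
Proof.
move=> x2; split=> // i j.
have := has_mx_integral_trace mK (has_mx_integralMl U mK (L2w_outer mK ww x2 x2)).
apply: (integrable_on_eq mK) => t _.
rewrite -scalemxAr linearZ /= mxE mulmxA mxtrace_mulC !mulmxA.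
by rewrite /mxtrace big_ord1 !ord1.
Qed.

(** The Gram bound is first rewritten as the value of the concave quadratic at
    an optimal vector [p]; the inequality then holds for arbitrary [p], as the
    integral of a pointwise Fenchel-Young gap. *)
Lemma bound_gram_le_energy (x : \bar R -> 'cV[R]_n) :
  L2w K w x ->
  ((bound_gram K w f U x)%:E <=
   integral_on K (fun t => w t * ((x t)^T *m U *m x t) 0 0)%R)%E.
Proof.
move=> x2; have IE := energy_integrable x2.
have -> : integral_on K (fun t => w t * ((x t)^T *m U *m x t) 0 0) =
  (mx_integral K (fun t => w t *: ((x t)^T *m U *m x t)) 0 0)%:E.
  have e t : K t -> w t * ((x t)^T *m U *m x t) 0 0 =
    (w t *: ((x t)^T *m U *m x t)) 0 0 by rewrite [RHS]mxE.
  rewrite (integral_on_eq e) mxE fineK //.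
  exact: (integrable_fin_num mK (IE.1 0 0)).
(* Any factorisation of the moment serves here; Omega = 1 is the simplest. *)
rewrite lee_fin -(bound_free_opt x2 (mul1mx _)) bound_freeE mul1mx.
move: (_ *m 1%:M *m _) => p.
have Im := moment_integral mK ww f2 x2.
have I1 := has_mx_integralMl p^T mK Im.
have I2 := has_mx_integralMr p mK (has_mx_integralT mK Im).
have I3 := has_mx_integralMr p mK
  (has_mx_integralMl p^T mK (kron1_conj_integral (invmx U) mK ww f2)).
have I := has_mx_integralD mK IE
  (has_mx_integralN mK (has_mx_integralD mK (has_mx_integralD mK I1 I2)
    (has_mx_integralN mK I3))).
rewrite -subr_ge0; have := has_mx_integral_ge0 I.
rewrite mxE [X in _ + X]mxE; apply => t Kt.
rewrite weighted_gap.
rewrite mxE mulr_ge0 //; first by case: ww => w0 _ _; exact: w0.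
rewrite mxE [X in _ + X]mxE subr_ge0; exact: fenchel_young.
Qed.

(** The difference of the two bounds is the weighted integral of the form of
    [Y - Y'] at the vectors [kron1 (rho * n) (f t) *m z]. *)
Lemma bound_slack_le (rho : nat) (Upsilon : 'M[R]_(d * n, rho * n))
    (z : 'cV[R]_(rho * n)) (X : 'M[R]_(n, d * (rho * n)))
    (Y Y' : 'M[R]_(d * (rho * n))) :
  (forall b : 'cV[R]_(d * (rho * n)),
    (b^T *m Y' *m b) 0 0 <= (b^T *m Y *m b) 0 0) ->
  bound_slack K w f Upsilon z X Y <= bound_slack K w f Upsilon z X Y'.
Proof.
move=> YY.
have I Z := has_mx_integralMr z mK (has_mx_integralMl z^T mK
  (slack_weight_integral Z mK ww f2)).
have E Z : bound_slack K w f Upsilon z X Z =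
    (z^T *m Sy (Upsilon^T *m vstack X) *m z) 0 0
    - (z^T *m slack_weight K w f Z *m z) 0 0.
  by rewrite /bound_slack mulmxBr mulmxBl mxE [X in _ + X]mxE.
rewrite !E lerD2l lerN2 -subr_ge0.
have := has_mx_integral_ge0 (has_mx_integralD mK (I Y) (has_mx_integralN mK (I Y'))).
rewrite mxE [X in _ + X]mxE; apply => t Kt.
rewrite mxE [X in _ + X]mxE subr_ge0 -!scalemxAr -!scalemxAl mxE [leRHS]mxE.
apply: ler_wpM2l; first by case: ww => w0 _ _; exact: w0.
by have := YY (kron1 (rho * n) (f t) *m z); rewrite trmx_mul !mulmxA.
Qed.

(** With the Schur complement as slack matrix, the integrated weight is
    (vstack X)^T (G *t U^-1) (vstack X), by [tr_kron1_vstack] followed by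
    [kron1_conj]. *)
Lemma bound_slack_schur (rho : nat) (Upsilon : 'M[R]_(d * n, rho * n))
    (z : 'cV[R]_(rho * n)) (X : 'M[R]_(n, d * (rho * n))) :
  bound_slack K w f Upsilon z X (X^T *m invmx U *m X) =
  bound_free K w f U Upsilon z (vstack X).
Proof.
rewrite /bound_slack /bound_free.
have -> : slack_weight K w f (X^T *m invmx U *m X) =
   (vstack X)^T *m (gram K w f *t invmx U) *m vstack X.
  have [_ <-] := has_mx_integralMr (vstack X) mK (has_mx_integralMl (vstack X)^T mK
    (kron1_conj_integral (invmx U) mK ww f2)).
  apply/matrixP => i j; rewrite mxE [RHS]mxE; congr fine.
  apply: integral_on_eq => t _; congr (fun_of_matrix _ i j).
  rewrite -scalemxAr -scalemxAl; congr (_ *: _).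
  rewrite !mulmxA -(mulmxA _ X) -tr_kron1_vstack -trmx_mul.
  by rewrite -tr_kron1_vstack trmx_mul trmxK !mulmxA.
suff -> : Sy (Upsilon^T *m vstack X) = Sy ((vstack X)^T *m Upsilon) by [].
by rewrite /Sy !trmx_mul !trmxK addrC.
Qed.

End Bounds.

Unset Implicit Arguments.
Set Strict Implicit.
Set Printing Implicit Defensive.

Theorem theorem4p4 (R : realType) (K : set (\bar R)) (w : \bar R -> R)
    (d n : nat) (U : 'M[R]_n) (f : \bar R -> 'cV[R]_d)
    (K_meas : lebesgue_measurable K) (K_size : lebesgue_size K != 0%E)
    (w_weight : is_weight K w)
    (U_posdef : posdef U)
    (f_L2 : L2w K w f) (f_gram : posdef (gram K w f)) :
  (forall (rho : nat) (Upsilon : 'M[R]_(d * n, rho * n)),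
     exists (X : 'M[R]_(n, d * (rho * n))) (Y : 'M[R]_(d * (rho * n))),
       slack_lmi U X Y /\
       forall (x : \bar R -> 'cV[R]_n) (z : 'cV[R]_(rho * n)),
         L2w K w x -> Upsilon *m z = moment K w f x ->
         bound_slack K w f Upsilon z X Y = bound_gram K w f U x) /\
  (forall (x : \bar R -> 'cV[R]_n) (nu : nat)
          (Omega : 'M[R]_(d * n, nu)) (zeta : 'cV[R]_nu)
          (rho : nat) (Upsilon : 'M[R]_(d * n, rho * n)) (z : 'cV[R]_(rho * n)),
     L2w K w x ->
     Omega *m zeta = moment K w f x ->
     Upsilon *m z = moment K w f x ->
     let energy := integral_on K (fun t => w t * ((x t)^T *m U *m x t) 0 0) in
     [/\ [/\ ((bound_gram K w f U x)%:E <= energy)%E,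
             forall H, ((bound_free K w f U Omega zeta H)%:E <= energy)%E
           & forall X Y, slack_lmi U X Y ->
               ((bound_slack K w f Upsilon z X Y)%:E <= energy)%E],
         is_maximum [set v | exists X Y, slack_lmi U X Y /\
                       v = bound_slack K w f Upsilon z X Y]
           (bound_gram K w f U x)
       & is_maximum [set v | exists H,
                       v = bound_free K w f U Omega zeta H]
           (bound_gram K w f U x)]).
Proof.
split=> [rho Upsilon|x nu Omega zeta rho Upsilon z x2 Oz Uz /=].
  have [X vX] := vstack_surj ((invmx (gram K w f) *t U) *m Upsilon).
  exists X, (X^T *m invmx U *m X); split=> [|x z x2 Uz]; first exact: schur_lmi.
  by rewrite bound_slack_schur // vX
    (bound_free_opt K_meas w_weight U_posdef f_L2 f_gram x2).
have slack_le X Y : slack_lmi U X Y ->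
    bound_slack K w f Upsilon z X Y <= bound_gram K w f U x.
  move=> XY; apply: le_trans (bound_free_le_gram K_meas w_weight U_posdef
    f_L2 f_gram (vstack X) x2 Uz).
  rewrite -(bound_slack_schur U K_meas w_weight f_L2).
  apply: (bound_slack_le K_meas w_weight f_L2) => b.
  exact: schur_complement.
have gram_le := bound_gram_le_energy K_meas w_weight U_posdef f_L2 f_gram x2.
split.
- split=> // [H|X Y XY]; apply: le_trans gram_le; rewrite lee_fin.
    exact: bound_free_le_gram.
  exact: slack_le.
- split=> [|_ [X [Y [XY ->]]]]; last exact: slack_le.
  have [X vX] := vstack_surj ((invmx (gram K w f) *t U) *m Upsilon).
  exists X, (X^T *m invmx U *m X); split; first exact: schur_lmi.
  by rewrite bound_slack_schur // vX
    (bound_free_opt K_meas w_weight U_posdef f_L2 f_gram x2).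
- split=> [|_ [H ->]]; last exact: bound_free_le_gram.
  by exists ((invmx (gram K w f) *t U) *m Omega); rewrite
    (bound_free_opt K_meas w_weight U_posdef f_L2 f_gram x2).
Qed.
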